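(* $\mathcal{Z} \subset \mathcal{C} \subset \mathcal{A} \subset \mathcal{I}_{3,1}$, where all three inclusions are proper.
   Context: An implicator groupoid is an algebra $\mathbf A = \langle A, \to, 0 \rangle$, with $\to$ binary and $0$ a constant, which, writing $x' := x \to 0$, satisfies the identities (I) $(x \to y) \to z \approx [(z' \to x) \to (y \to z)']'$ and (I$_0$) $0'' \approx 0$. $\mathcal{Z}$, $\mathcal{C}$, $\mathcal{A}$, $\mathcal{I}_{3,1}$ are the varieties of implicator groupoids satisfying, respectively, $x \to y \approx 0$; $x \to y \approx y \to x$; $(x \to y) \to z \approx x \to (y \to z)$; $x''' \approx x'$. *)

(* Defs.v *)
From mathcomp Require Import all_boot.
From mathcomp Require Import classical_sets.

Set Implicit Arguments.
Unset Strict Implicit.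
Unset Printing Implicit Defensive.

Local Open Scope classical_set_scope.

(* Algebras of type (2, 0), with no equations assumed. *)
Record algebra20 : Type := Algebra20 {
  carrier :> Type;
  imp : carrier -> carrier -> carrier;
  zero : carrier
}.

Arguments zero {_}.

Declare Scope implicator_scope.
Delimit Scope implicator_scope with implicator.
Notation "x ~> y" := (imp x y)
  (at level 55, right associativity) : implicator_scope.
Local Open Scope implicator_scope.

(* The derived operation written x' in the literature. *)
Definition neg (A : algebra20) (x : A) : A := x ~> zero.

Definition identity_I (A : algebra20) : Prop :=
  forall x y z : A,
    (x ~> y) ~> z = neg ((neg z ~> x) ~> neg (y ~> z)).

Definition identity_I0 (A : algebra20) : Prop := neg (neg zero) = zero :> A.

(* A variety is represented by the class of its members. *)
Definition implicator_groupoid : set algebra20 :=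
  [set A : algebra20 | identity_I A /\ identity_I0 A].

Definition variety_Z : set algebra20 :=
  implicator_groupoid `&` [set A : algebra20 | forall x y : A, x ~> y = zero].

Definition variety_C : set algebra20 :=
  implicator_groupoid `&` [set A : algebra20 | forall x y : A, x ~> y = y ~> x].

Definition variety_A : set algebra20 :=
  implicator_groupoid `&`
  [set A : algebra20 | forall x y z : A, (x ~> y) ~> z = x ~> (y ~> z)].

Definition variety_I31 : set algebra20 :=
  implicator_groupoid `&` [set A : algebra20 | forall x : A, neg (neg (neg x)) = neg x].

(* Main.v *)
Require Import Defs.
From mathcomp Require Import all_boot.
From mathcomp Require Import classical_sets.
Local Open Scope classical_set_scope.

(** The inclusion Z in C is immediate, and A in I_{3,1} holds because in an
    associative groupoid x''' is x multiplied by 0'' = 0.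

    The content is that commutativity implies associativity
    ([comm_implicator_assoc]). Commutativity first forces 0' = 0
    ([comm_neg0]), after which negation becomes an idempotent retraction that
    can be inserted or removed on any factor of a product under a negation
    ([comm_negl], [comm_neg_neg]). Identity (I) then reads
    (x ~> y) ~> z = ((z ~> x) ~> (y ~> z))' ([comm_I]), so that every product
    of three elements lies in the image of negation. On that image ~> is
    commutative, distributes over itself and has the unit 0. Such an operation
    is a semilattice join: distributivity with the unit gives idempotence and
    absorption, and the relation [below] is an order for which x ~> y is the
    least upper bound of x and y. Both bracketings of a triple product are
    then least upper bounds of the same three elements, hence equal.

    The inclusions are proper because of the two-element join semilattice with
    least element 0 (in C, not in Z), a noncommutative semigroup in which all
    triple products are 0 (in A, not in C), and the two-element Boolean algebra
    with its implication (in I_{3,1}, not in A). *)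

Local Open Scope implicator_scope.

(** * Commutative implicator groupoids are associative *)

Section Commutative.

Variable A : algebra20.
Hypothesis implI : identity_I A.
Hypothesis implI0 : identity_I0 A.
Hypothesis impC : forall x y : A, x ~> y = y ~> x.

Local Notation "0" := (@Defs.zero A).

Lemma comm_zero_imp (x : A) : 0 ~> x = neg x.
Proof. exact: impC. Qed.

(** At x = z = 0' and y = 0, identity (I) has left side 0'' = 0 and right side
    0', since 0''' = 0'. *)
Lemma comm_neg0 : neg 0 = 0.
Proof.
have e0 : neg (neg 0) = 0 by exact: implI0.
have := implI (neg 0) 0 (neg 0).
by rewrite -/(neg (neg 0)) e0 comm_zero_imp !e0 comm_zero_imp e0 => <-.
Qed.

Lemma comm_neg3 (x : A) : neg (neg (neg x)) = neg (neg x).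
Proof.
have := implI x 0 0.
rewrite -/(neg 0) !comm_neg0 comm_zero_imp -/(neg x) -/(neg (neg x)).
by move=> {2}->.
Qed.

(** Identity (I) at z = 0 gives (y ~> x)' = (y' ~> x'')', whose right side is
    unchanged when x is replaced by x', because x''' = x''. *)
Lemma comm_negl (x y : A) : neg (neg x ~> y) = neg (x ~> y).
Proof.
have I_at_zero (u v : A) : neg (u ~> v) = neg (neg u ~> neg (neg v)).
  by have := implI u v 0; rewrite comm_neg0 comm_zero_imp.
by rewrite (impC (neg x)) I_at_zero comm_neg3 -I_at_zero impC.
Qed.

Lemma comm_negr (x y : A) : neg (x ~> neg y) = neg (x ~> y).
Proof. by rewrite impC comm_negl impC. Qed.

(** Identity (I) at x = y = 0 is z' = (z'' ~> z'')'. *)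
Lemma comm_neg_square (x : A) : neg (x ~> x) = neg x.
Proof.
have := implI 0 0 x.
rewrite -/(neg 0) comm_neg0 comm_zero_imp => ->.
by rewrite -/(neg (neg x)) !(comm_negl, comm_negr).
Qed.

Lemma comm_neg_neg (x : A) : neg (neg x) = neg x.
Proof. by rewrite -comm_neg_square comm_negl comm_negr comm_neg_square. Qed.

(** Every factor on the right of (I) stands under the outer negation, so the
    inner negations can be dropped. On the image of negation, where the outer
    one also disappears, what is left is self-distributivity. *)
Lemma comm_I (x y z : A) : (x ~> y) ~> z = neg ((z ~> x) ~> (y ~> z)).
Proof.
by rewrite implI comm_negr -(comm_negl (neg z ~> x)) (comm_negl z) comm_negl.
Qed.

Lemma comm_neg_triple (x y z : A) : neg ((x ~> y) ~> z) = (x ~> y) ~> z.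
Proof. by rewrite comm_I comm_neg_neg. Qed.

(** The semilattice order on the image of negation, pulled back along negation
    so that no subalgebra has to be formed; on A it is only a preorder. *)
Definition below (x y : A) : Prop := neg (x ~> y) = neg y.

(** Absorption is self-distributivity with one factor equal to the unit 0. *)
Lemma below_impr (x y : A) : below y (x ~> y).
Proof.
rewrite /below -(comm_negl y) -(comm_negl x).
have := comm_I 0 x y; rewrite comm_zero_imp -/(neg y) => ->.
by rewrite comm_neg_neg comm_negl.
Qed.

Lemma below_impl (x y : A) : below x (x ~> y).
Proof. by rewrite impC; exact: below_impr. Qed.

Lemma below_lub (x y z : A) : below x z -> below y z -> below (x ~> y) z.
Proof.
rewrite /below => xz yz.
rewrite comm_I comm_neg_neg -comm_negl -comm_negr (impC z) xz yz.
by rewrite comm_negl comm_negr comm_neg_square.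
Qed.

(** By distributivity z = y z = (x y) z = (x z) (y z) = (x z) z, which is
    x z by absorption. *)
Lemma below_trans (x y z : A) : below x y -> below y z -> below x z.
Proof.
rewrite /below => xy yz.
have := comm_I x y z; rewrite -comm_neg_triple -comm_negl xy comm_negl yz.
rewrite -comm_negr yz comm_negr (impC z) (impC _ z) => ->.
by rewrite below_impr.
Qed.

Lemma below_antisym (x y : A) : below x y -> below y x -> neg x = neg y.
Proof. by rewrite /below impC => -> ->. Qed.

Lemma comm_implicator_assoc (x y z : A) : (x ~> y) ~> z = x ~> (y ~> z).
Proof.
rewrite -comm_neg_triple (impC x (y ~> z)) -[RHS]comm_neg_triple.
apply: below_antisym.
- apply: below_lub; first apply: below_lub.
  + exact: below_impr.
  + exact: below_trans (below_impl y z) (below_impl _ _).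
  + exact: below_trans (below_impr y z) (below_impl _ _).
- apply: below_lub; first apply: below_lub.
  + exact: below_trans (below_impr x y) (below_impl _ _).
  + exact: below_impr.
  + exact: below_trans (below_impl x y) (below_impl _ _).
Qed.

End Commutative.

(** * Separating examples *)

Definition join_semilattice2 : algebra20 := Algebra20 orb false.

Definition boolean_implication : algebra20 := Algebra20 implb false.

(** The only nonzero product is 1 ~> 2 = 3, and 3 annihilates everything, so
    all triple products vanish while 1 and 2 do not commute. *)
Definition nilpotent_semigroup : algebra20 :=
  Algebra20 (fun m n : nat => if (m == 1) && (n == 2) then 3 else 0) 0.

Lemma join_semilattice2_in_C : variety_C join_semilattice2.
Proof. by split=> [|[] []] //; split=> // -[] [] []. Qed.

Lemma join_semilattice2_notin_Z : ~ variety_Z join_semilattice2.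
Proof. by case=> _ /(_ true true). Qed.

Lemma nilpotent_semigroup_triple (x y z : nilpotent_semigroup) :
  (x ~> y) ~> z = Defs.zero /\ x ~> (y ~> z) = Defs.zero.
Proof.
split=> /=; first by case: (_ && (y == 2)).
by case: ((y == 1) && _); rewrite andbF.
Qed.

Lemma nilpotent_semigroup_in_A : variety_A nilpotent_semigroup.
Proof.
have tripleL x y z := (nilpotent_semigroup_triple x y z).1.
have tripleR x y z := (nilpotent_semigroup_triple x y z).2.
split=> [|x y z /=]; last by rewrite [LHS]tripleL [RHS]tripleR.
by split=> // x y z; rewrite /neg !tripleL.
Qed.

Lemma nilpotent_semigroup_notin_C : ~ variety_C nilpotent_semigroup.
Proof. by case=> _ /(_ 1 2). Qed.

Lemma boolean_implication_in_I31 : variety_I31 boolean_implication.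
Proof. by split=> [|[]] //; split=> // -[] [] []. Qed.

Lemma boolean_implication_notin_A : ~ variety_A boolean_implication.
Proof. by case=> _ /(_ false false false). Qed.

(** * The chain of varieties *)

Lemma variety_Z_sub_C : variety_Z `<=` variety_C.
Proof. by move=> A [implA imp0]; split=> // x y; rewrite !imp0. Qed.

Lemma variety_C_sub_A : variety_C `<=` variety_A.
Proof.
move=> A [[implI implI0] impC]; split=> // x y z.
exact: comm_implicator_assoc.
Qed.

Lemma variety_A_sub_I31 : variety_A `<=` variety_I31.
Proof.
move=> A [[implI implI0] impA]; split=> // x.
have zero3 : Defs.zero ~> (Defs.zero ~> Defs.zero) = Defs.zero :> A.
  by rewrite -impA; exact: implI0.
by rewrite /neg !impA zero3.
Qed.

Local Close Scope implicator_scope.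

Theorem theorem8p2 :
  [/\ variety_Z `<` variety_C,
      variety_C `<` variety_A &
      variety_A `<` variety_I31].
Proof.
split; split.
- exact: variety_Z_sub_C.
- by move=> /(_ _ join_semilattice2_in_C); exact: join_semilattice2_notin_Z.
- exact: variety_C_sub_A.
- by move=> /(_ _ nilpotent_semigroup_in_A); exact: nilpotent_semigroup_notin_C.
- exact: variety_A_sub_I31.
- move=> /(_ _ boolean_implication_in_I31).
  exact: boolean_implication_notin_A.
Qed.
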